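(* Let $m\ge 2$ be an integer and let $M_{\mathrm{abel},m}=\langle a,b \mid a^m=b^m,\ ab=ba\rangle_{mo}$, with $\deg$ the word length. Its skew growth function is, as a formal power series in $t$, $$N_{M_{\mathrm{abel}, m},\deg}(t)=\frac{(1-t)^2}{1-t^m}.$$
   Context: $\langle L\mid R\rangle_{mo}$ denotes the monoid presented by a finite set of generators $L$ and relations $R$, i.e. the quotient of the free monoid $L^*$ by the congruence generated by $R$. All relations equate words of equal length, so the length of words gives a well-defined homomorphism $\deg:M\to\mathbb{Z}_{\ge 0}$. The monoid considered here is cancellative. Let $M=\langle L\mid R\rangle_{mo}$ be such a monoid. For $u,v\in M$ write $u|_l v$ if $v=ux$ for some $x\in M$. For a subset $J\subset M$ put $\mathrm{cm}_r(J)=\{u\in M: j|_l u \text{ for all } j\in J\}$, $\mathrm{min}_r(J)=\{u\in J: \text{every } v\in J \text{ with } v|_l u \text{ equals } u\}$, and $\mathrm{mcm}(J)=\mathrm{min}_r(\mathrm{cm}_r(J))$. A tower of $M$ of height $p\in\mathbb{Z}_{\ge0}$ is a sequence $T=(I_0,J_1,\dots,J_p)$ of subsets of $M$, where $I_0$ is the image of $L$ in $M$, such that, putting $I_k:=\mathrm{mcm}(J_k)$, for each $k=1,\dots,p$ one has $J_k\subset I_{k-1}$, $1<\#J_k<\infty$ and $I_k\neq\emptyset$. Put $|T|:=I_p$. $\mathrm{Tmcm}(M)$ is the set of all towers (including the height-$0$ tower $(I_0)$). The skew growth function is the formal power series $$N_{M,\deg}(t)=1+\sum_{T=(I_0,J_1,\dots,J_p)\in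 \mathrm{Tmcm}(M)}(-1)^{\#J_1+\cdots+\#J_p-p+1}\sum_{\Delta\in|T|}t^{\deg(\Delta)}.$$ *)

(* Defs.v *)
From HB Require Import structures.
From mathcomp Require Import all_boot all_order all_algebra generic_quotient.
From mathcomp Require Import boolp classical_sets functions cardinality fsbigop.
From mathcomp Require Import finmap.

Set Implicit Arguments.
Unset Strict Implicit.
Unset Printing Implicit Defensive.

Import GRing.Theory.
Local Open Scope classical_set_scope.
Local Open Scope ring_scope.

(** * Formal power series [R[[t]]] *)

(* A record rather than a bare function type, so that the product is not
   confused with the pointwise product of functions. *)
Record fps (R : Type) := Fps { fpscoef : nat -> R }.
Coercion fpscoef : fps >-> Funclass.

Lemma fpsP (R : Type) (f g : fps R) : (forall n, f n = g n) <-> f = g.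
Proof.
split=> [|-> //]; case: f g => [f] [g] /= fg.
by congr Fps; apply/funext.
Qed.

HB.instance Definition _ (R : Type) := gen_eqMixin (fps R).
HB.instance Definition _ (R : Type) := gen_choiceMixin (fps R).

Section FpsZmod.
Variable R : zmodType.
Implicit Types f g h : fps R.

Definition fps_zero : fps R := Fps (fun=> 0).
Definition fps_opp f : fps R := Fps (fun n => - f n).
Definition fps_add f g : fps R := Fps (fun n => f n + g n).

Fact fps_addA : associative fps_add.
Proof. by move=> f g h; apply/fpsP => n /=; rewrite addrA. Qed.
Fact fps_addC : commutative fps_add.
Proof. by move=> f g; apply/fpsP => n /=; rewrite addrC. Qed.
Fact fps_add0 : left_id fps_zero fps_add.
Proof. by move=> f; apply/fpsP => n /=; rewrite add0r. Qed.
Fact fps_addN : left_inverse fps_zero fps_opp fps_add.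
Proof. by move=> f; apply/fpsP => n /=; rewrite addNr. Qed.

HB.instance Definition _ :=
  GRing.isZmodule.Build (fps R) fps_addA fps_addC fps_add0 fps_addN.

End FpsZmod.

Section FpsRing.
Variable R : comNzRingType.
Implicit Types f g h : fps R.

Definition fps_one : fps R := Fps (fun n => (n == 0)%:R).
Definition fps_mul f g : fps R :=
  Fps (fun n => \sum_(i < n.+1) f i * g (n - i)%N).

Let tr n f : {poly R} := \poly_(i < n.+1) f i.

Let coef_tr n f k : (k <= n)%N -> (tr n f)`_k = f k.
Proof. by move=> kn; rewrite coef_poly ltnS kn. Qed.

Let coef_trM n f g k : (k <= n)%N -> (tr n f * tr n g)`_k = fps_mul f g k.
Proof.
move=> kn; rewrite coefM; apply: eq_bigr => i _.
by rewrite !coef_tr // (leq_trans _ kn) ?leq_subr// -ltnS.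
Qed.

Let eq_coefMr n (p q r : {poly R}) : (forall k, (k <= n)%N -> q`_k = r`_k) ->
  (p * q)`_n = (p * r)`_n.
Proof.
by move=> qr; rewrite !coefM; apply: eq_bigr => i _; rewrite qr// leq_subr.
Qed.

Fact fps_mulC : commutative fps_mul.
Proof.
by move=> f g; apply/fpsP => n; rewrite -!(@coef_trM n)// mulrC.
Qed.

Fact fps_mulA : associative fps_mul.
Proof.
move=> f g h; apply/fpsP => n; rewrite [fps_mul (fps_mul f g) h]fps_mulC.
rewrite -!(@coef_trM n)//.
rewrite (@eq_coefMr _ _ _ (tr n g * tr n h)); last first.
  by move=> k kn; rewrite coef_tr// coef_trM.
rewrite mulrA [RHS](@eq_coefMr _ _ _ (tr n f * tr n g)); last first.
  by move=> k kn; rewrite coef_tr// coef_trM.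
by rewrite mulrC.
Qed.

Fact fps_mul1 : left_id fps_one fps_mul.
Proof.
move=> f; apply/fpsP => n /=; rewrite big_ord_recl /= subn0 mul1r.
by rewrite big1 ?addr0// => i _; rewrite mul0r.
Qed.

Fact fps_mulDl : left_distributive fps_mul +%R.
Proof.
move=> f g h; apply/fpsP => n /=; rewrite -big_split /=.
by apply: eq_bigr => i _; rewrite mulrDl.
Qed.

Fact fps_one_neq0 : fps_one != 0.
Proof. by apply/eqP => /fpsP/(_ 0); apply/eqP; exact: oner_neq0. Qed.

HB.instance Definition _ := GRing.Zmodule_isComNzRing.Build (fps R)
  fps_mulA fps_mulC fps_mul1 fps_mulDl fps_one_neq0.

Definition fpsX : fps R := Fps (fun n => (n == 1)%:R).

Lemma coef_fpsD f g n : (f + g) n = f n + g n. Proof. by []. Qed.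
Lemma coef_fpsN f n : (- f) n = - f n. Proof. by []. Qed.
Lemma coef_fps1 n : (1 : fps R) n = (n == 0)%:R. Proof. by []. Qed.
Lemma coef_fpsM f g n : (f * g) n = \sum_(i < n.+1) f i * g (n - i)%N.
Proof. by []. Qed.

Lemma coef_fpsXM f n : (fpsX * f) n = if n is n'.+1 then f n' else 0.
Proof.
rewrite coef_fpsM big_ord_recl /= mul0r add0r; case: n => [|n].
  by rewrite big_ord0.
rewrite big_ord_recl /= mul1r subn1 big1 ?addr0// => i _.
by rewrite mul0r.
Qed.

Lemma coef_fpsXn k n : (fpsX ^+ k) n = (n == k)%:R.
Proof. by elim: k n => [|k IH] [|n] //; rewrite exprS coef_fpsXM// IH. Qed.

(* Sum of a possibly infinite family of power series, coefficient by
   coefficient. It is meaningful when [fps_summable A F]: the sum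
   [\sum_(i \in A)] is 0 when the support is infinite. *)
Definition fps_sum (I : choiceType) (A : set I) (F : I -> fps R) : fps R :=
  Fps (fun n => \sum_(i \in A) F i n).

Definition fps_summable (I : choiceType) (A : set I) (F : I -> fps R) :=
  forall n, finite_set (A `&` [set i | F i n != 0]).

End FpsRing.

Arguments fpsX {R}.

Section FpsUnitRing.
Variable R : comUnitRingType.
Implicit Types f g : fps R.

Definition fps_unit : pred (fps R) := fun f => f 0 \is a GRing.unit.

(* The first n+1 coefficients of the inverse of f, from the recursion
   g_(n+1) = - f_0^-1 (f_1 g_n + ... + f_(n+1) g_0). *)
Fixpoint fps_inv_seq f n : seq R :=
  if n is n'.+1 then
    let s := fps_inv_seq f n' in
    rcons s (- (f 0)^-1 * \sum_(i < n'.+1) f i.+1 * s`_(n' - i))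
  else [:: (f 0)^-1].

Definition fps_inv f : fps R :=
  if fps_unit f then Fps (fun n => (fps_inv_seq f n)`_n) else f.

Let size_inv_seq f n : size (fps_inv_seq f n) = n.+1.
Proof. by elim: n => //= n IH; rewrite size_rcons IH. Qed.

Let nth_inv_seq f n k : (k <= n)%N ->
  (fps_inv_seq f n)`_k = (fps_inv_seq f k)`_k.
Proof.
elim: n => [|n IH]; first by rewrite leqn0 => /eqP->.
rewrite leq_eqVlt => /predU1P[-> //|kn] /=.
by rewrite nth_rcons size_inv_seq kn IH.
Qed.

Fact fps_mulVr : {in fps_unit, left_inverse 1 fps_inv *%R}.
Proof.
move=> f f_unit; rewrite /fps_inv (f_unit : fps_unit f) mulrC.
have f0 : f 0 \is a GRing.unit by [].
apply/fpsP => -[|n]; first by rewrite coef_fpsM big_ord1 /= divrr.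
rewrite coef_fpsM big_ord_recl subn0 /= nth_rcons size_inv_seq ltnn eqxx.
rewrite mulNr mulrN mulVKr// addrC; apply/eqP; rewrite subr_eq0; apply/eqP.
by apply: eq_bigr => i _; rewrite subSS [in RHS]nth_inv_seq ?leq_subr.
Qed.

Fact fps_unitP f g : g * f = 1 -> fps_unit f.
Proof.
move=> /fpsP/(_ 0); rewrite coef_fpsM big_ord1 /= => gf.
by apply/unitrPr; exists (g 0); rewrite mulrC.
Qed.

Fact fps_inv_out : {in [predC fps_unit], fps_inv =1 id}.
Proof. by move=> f /negPf nf; rewrite /fps_inv (nf : fps_unit f = false). Qed.

HB.instance Definition _ := GRing.ComNzRing_hasMulInverse.Build (fps R)
  fps_mulVr fps_unitP fps_inv_out.

Lemma fps_unitE f : (f \is a GRing.unit) = (f 0 \is a GRing.unit).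
Proof. by []. Qed.

Lemma unit_1subXn m : (0 < m)%N -> (1 - fpsX ^+ m : fps R) \is a GRing.unit.
Proof.
case: m => // m _; rewrite fps_unitE coef_fpsD coef_fpsN coef_fpsXn coef_fps1.
by rewrite subr0 unitr1.
Qed.

End FpsUnitRing.

(** * Towers of minimal common multiples and the skew growth function *)

Section SkewGrowth.
Local Open Scope group_scope.
Variable M : monoidType.
Implicit Types (u v : M) (J : set M).

Definition ldivides u v := exists x, v = u * x.
Definition cm_r J : set M := [set u | forall j, J j -> ldivides j u].
Definition min_r J : set M :=
  [set u | J u /\ forall v, J v -> ldivides v u -> v = u].
Definition mcm J : set M := min_r (cm_r J).

(* #J, for a finite set J *)
Definition card J : nat := #|` fset_set J|.

(* A tower (I0, J_1, ..., J_p) is represented by the list [:: J_1; ...; J_p],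
   so that J_(k+1) = Js`_k and I_k = (I0 :: map mcm Js)`_k. *)
Definition tower (I0 : set M) (Js : seq (set M)) : Prop :=
  forall k, (k < size Js)%N ->
    let J := nth set0 Js k in
    [/\ J `<=` nth set0 (I0 :: map mcm Js) k,
        finite_set J, (1 < card J)%N & mcm J !=set0].

Definition tower_top (I0 : set M) (Js : seq (set M)) : set M :=
  last I0 (map mcm Js).

(* For a tower every #J_k is at least 2, so the subtraction is exact. *)
Definition tower_sign (Js : seq (set M)) : fps int :=
  ((-1) ^+ ((\sum_(J <- Js) card J) - size Js + 1))%R.

Definition tower_term (I0 : set M) (deg : M -> nat) Js : fps int :=
  (tower_sign Js * fps_sum (tower_top I0 Js) (fun D => fpsX ^+ deg D))%R.

Definition skew_growth (I0 : set M) (deg : M -> nat) : fps int :=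
  (1 + fps_sum (tower I0) (tower_term I0 deg))%R.

End SkewGrowth.

(** * Finitely presented monoids *)

Section Presentation.
Local Open Scope quotient_scope.
Variables (L : finType) (R : seq (seq L * seq L)).

Inductive mo_cong : seq L -> seq L -> Prop :=
| mo_rel u v : (u, v) \in R -> mo_cong u v
| mo_refl u : mo_cong u u
| mo_sym u v : mo_cong u v -> mo_cong v u
| mo_trans v u w : mo_cong u v -> mo_cong v w -> mo_cong u w
| mo_cat u u' v v' :
    mo_cong u u' -> mo_cong v v' -> mo_cong (u ++ v) (u' ++ v').

Definition mo_eqv : rel (seq L) := fun u v => `[< mo_cong u v >].

Fact mo_eqv_equiv : equiv_class_of mo_eqv.
Proof.
split=> [u|u v|v u w]; first exact/asboolP/mo_refl.
  by apply/asboolP/asboolP; exact: mo_sym.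
by move=> /asboolP uv /asboolP vw; apply/asboolP/(mo_trans uv vw).
Qed.

Canonical mo_eqv_canonical := EquivRelPack mo_eqv_equiv.

Definition presented : Type := {eq_quot mo_eqv}.

HB.instance Definition _ := Choice.on presented.
HB.instance Definition _ : EqQuotient (seq L) mo_eqv presented :=
  EqQuotient.on presented.

Definition word (w : seq L) : presented := \pi w.

Lemma wordP u v : word u = word v <-> mo_cong u v.
Proof.
by rewrite /word; split=> [/eqmodP/asboolP|uv] //; apply/eqmodP/asboolP.
Qed.

Lemma word_repr (x : presented) : word (repr x) = x.
Proof. exact: reprK. Qed.

Definition presented_one : presented := word [::].
Definition presented_mul (x y : presented) : presented :=
  word (repr x ++ repr y).

Lemma presented_mulE u v : presented_mul (word u) (word v) = word (u ++ v).
Proof. by apply/wordP/mo_cat; apply/wordP; rewrite word_repr. Qed.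

Fact presented_mulA : associative presented_mul.
Proof.
move=> x y z; rewrite -(word_repr x) -(word_repr y) -(word_repr z).
by rewrite !presented_mulE catA.
Qed.

Fact presented_mul1 : left_id presented_one presented_mul.
Proof. by move=> x; rewrite -(word_repr x) presented_mulE. Qed.

Fact presented_mulr1 : right_id presented_one presented_mul.
Proof. by move=> x; rewrite -(word_repr x) presented_mulE cats0. Qed.

HB.instance Definition _ := isMonoid.Build presented
  presented_mulA presented_mul1 presented_mulr1.

Lemma word_cat u v : word (u ++ v) = (word u * word v)%g.
Proof. by rewrite -presented_mulE. Qed.

(* The image of L, written I_0 for towers. *)
Definition generators : set presented := range (fun a : L => word [:: a]).

(* The length of some representative; by [deg_word] and [degM] it is the degree
   homomorphism as soon as the relations preserve length. *)
Definition deg (x : presented) : nat := size (repr x).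

Definition homogeneous := forall u v, (u, v) \in R -> size u = size v.

Lemma deg_word w : homogeneous -> deg (word w) = size w.
Proof.
move=> hR; suff cong_size u v : mo_cong u v -> size u = size v.
  by apply: cong_size; apply/wordP; rewrite word_repr.
elim=> {u v} [u v /hR //|//|u v _ -> //|v u w' _ -> _ -> //|u u' v v' _ + _].
by rewrite !size_cat => -> ->.
Qed.

Lemma degM x y : homogeneous -> deg (x * y)%g = (deg x + deg y)%N.
Proof.
move=> hR; rewrite -(word_repr x) -(word_repr y) -word_cat.
by rewrite !deg_word// size_cat.
Qed.

End Presentation.

Section Summable.
Variables (L : finType) (R : seq (seq L * seq L)).
Hypothesis hR : homogeneous R.
Local Notation M := (presented R).
Implicit Types (x y z : M) (I J : set M) (Js : seq (set M)).

Let deg0 x : deg x = 0 -> x = 1%g.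
Proof. by move/size0nil => x0; rewrite -(word_repr x) x0. Qed.

Let ldivides_eq x y : ldivides x y -> (deg y <= deg x)%N -> x = y.
Proof.
move=> [z ->]; rewrite degM// -{2}[deg x]addn0 leq_add2l leqn0 => /eqP/deg0->.
by rewrite mulg1.
Qed.

Let leq_deg x y : ldivides x y -> (deg x <= deg y)%N.
Proof. by move=> [z ->]; rewrite degM// leq_addr. Qed.

Let finite_deg n : finite_set [set x : M | (deg x <= n)%N].
Proof.
apply: (@sub_finite_set _ _
  (\bigcup_(k in `I_n.+1) range (fun t : k.-tuple L => word R t))).
  move=> x /= xn; exists (deg x); first by rewrite /= ltnS.
  by exists (in_tuple (repr x)) => //; rewrite /= word_repr.
by apply: bigcup_finite => // k _; apply: finite_image.
Qed.

Let antichain I := forall x y, I x -> I y -> ldivides x y -> x = y.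

Let antichain_mcm J : antichain (mcm J).
Proof. by move=> x y [Jx _] [_ ymin] /(ymin _ Jx). Qed.

Let antichain_generators : antichain (@generators L R).
Proof.
move=> _ _ [a _ <-] [b _ <-] /ldivides_eq; apply.
by rewrite !deg_word.
Qed.

Let towerS I J Js : tower I (J :: Js) ->
  [/\ J `<=` I, finite_set J & (1 < card J)%N] /\ tower (mcm J) Js.
Proof.
move=> T; split; first by have [] := T 0 isT.
by move=> k kJs; have := T k.+1 kJs.
Qed.

Let tower_deg Js I x : antichain I -> tower I Js -> tower_top I Js x ->
  (exists2 y, I y & (deg y + size Js <= deg x)%N) /\
  (forall J, J \in Js -> J `<=` [set y | (deg y <= deg x)%N]).
Proof.
elim: Js I => [|J Js IH] I acI.
  by move=> _ /= Ix; split=> //; exists x; rewrite ?addn0.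
move=> /towerS[[JI finJ cardJ] T] xT.
have [[y [yJ ymin] yx] JsP] := IH _ (@antichain_mcm J) T xT.
have yx' : (deg y <= deg x)%N by rewrite (leq_trans _ yx)// leq_addr.
split.
  have [j1 [j2 [J1 J2 j12]]] : exists j1 j2, [/\ J j1, J j2 & j1 != j2].
    move: cardJ; rewrite /card cardfE => /card_gt1P[j1 [j2 [_ _ j12]]].
    exists (val j1), (val j2).
    have inJ (j : fset_set J) : J (val j).
      by have := valP j; rewrite in_fset_set// => /set_mem.
    by split.
  exists j1; first exact: JI.
  rewrite /= addnS -addSn (leq_trans _ yx)// leq_add2r ltnNge.
  apply: contra j12 => /(ldivides_eq (yJ _ J1)) j1y; apply/eqP/esym.
  by apply: acI; [exact: JI|exact: JI|rewrite j1y; exact: yJ].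
move=> K; rewrite inE => /predU1P[-> j /yJ/leq_deg jy|/JsP//].
exact: leq_trans yx'.
Qed.

Let finite_seqs (T : choiceType) (S : set T) k : finite_set S ->
  finite_set [set s : seq T | size s = k /\ {in s, forall t, S t}].
Proof.
move=> finS; elim: k => [|k IH].
  apply: (@sub_finite_set _ _ [set [::]]) => // s [/size0nil -> //].
apply: (sub_finite_set _ (finite_image2 cons finS IH)) => -[[//]|t s [[sk] sS]].
exists t; first by apply: sS; rewrite mem_head.
by exists s => //; split=> // y ys; apply: sS; rewrite inE ys orbT.
Qed.

(* Both infinite sums in the definition of the skew growth function make sense
   for every finite homogeneous presentation. *)
Lemma summable_top (A : set M) :
  fps_summable A (fun D => fpsX ^+ deg D : fps int).
Proof.
move=> n; apply: sub_finite_set (finite_deg n) => x [_] /=.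
by rewrite coef_fpsXn; case: (n =P deg x) => [->|_ /eqP].
Qed.

Lemma summable_tower :
  fps_summable (tower (@generators L R))
    (tower_term (@generators L R) (@deg L R)).
Proof.
move=> n; pose S := [set J : set M | J `<=` [set x | (deg x <= n)%N]].
have finS : finite_set S.
  rewrite /S; have /finite_fsetP[X ->] := finite_deg n.
  apply: (@sub_finite_set _ _
    ((fun Y : {fset M} => [set` Y]) @` [set` fpowerset X])).
    move=> J JX; have finJ : finite_set J by exact: sub_finite_set JX _.
    exists (fset_set J); last exact: fset_setK.
    rewrite /= fpowersetE; apply/fsubsetP => x.
    by rewrite in_fset_set// => /set_mem/JX.
  exact: finite_image.
apply: (@sub_finite_set _ _ (\bigcup_(k in `I_n.+1)
    [set Js | size Js = k /\ {in Js, forall J, S J}])); last first.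
  by apply: bigcup_finite => // k _; exact: finite_seqs.
move=> Js [T]; rewrite /mkset /tower_term coef_fpsM => nz.
have [x Tx xn] : exists2 x, tower_top (@generators L R) Js x & (deg x <= n)%N.
  apply: contrapT => no; move/eqP: nz; apply.
  apply: big1 => i _; rewrite [X in _ * X]fsbig1 ?mulr0// => x Tx.
  rewrite coef_fpsXn; case: eqP => // xn; case: no; exists x => //.
  by rewrite -xn leq_subr.
have [[y _ yx] JsP] := tower_deg antichain_generators T Tx.
exists (size Js).
  by rewrite /= ltnS (leq_trans _ xn)// (leq_trans _ yx)// leq_addl.
by split=> // J /JsP JP y' /JP y'x; rewrite /= (leq_trans y'x).
Qed.

End Summable.

Definition presented_skew_growth (L : finType) (R : seq (seq L * seq L)) :
    fps int :=
  skew_growth (@generators L R) (@deg L R).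

(** * The monoid [< a, b | a^m = b^m, ab = ba >] *)

(* The letters a and b are [false] and [true]. *)
Definition abel_relations (m : nat) : seq (seq bool * seq bool) :=
  let a := false in let b := true in
  [:: (nseq m a, nseq m b); ([:: a; b], [:: b; a])].

Lemma homogeneous_abel m : homogeneous (abel_relations m).
Proof.
by move=> u v; rewrite !inE => /orP[] /eqP[-> ->]; rewrite ?size_nseq.
Qed.

(* Main.v *)
(* Every element is some a^i b^j, and a^i b^j = a^i' b^j' exactly when the
   degrees agree and j = j' mod m.  Hence, writing I_k for the top of a tower of
   height k, the sets
     I_(2k) = {a^(mk) a, a^(mk) b},  I_(2k+1) = {a^(mk) ab, a^(mk) a^m}
   satisfy mcm I_k = I_(k+1).  As they have two elements, J_(k+1) must be all of
   I_k: there is one tower of each height p, with sign (-1)^(p+1).  The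
   resulting alternating sum is geometric of ratio t^m,
     N(t) = 1 + (t^2 + t^m - 2t) / (1 - t^m). *)
Require Import Defs.
From mathcomp Require Import all_boot all_order all_algebra.
From mathcomp Require Import finmap zify ring.
From mathcomp Require Import boolp classical_sets cardinality fsbigop.

Set Implicit Arguments.
Unset Strict Implicit.
Unset Printing Implicit Defensive.

Import GRing.Theory.
Local Open Scope classical_set_scope.
Local Open Scope ring_scope.

(** * Coefficients and sums of power series *)

Lemma coef_fpsXnM (R : comNzRingType) (f : fps R) k n :
  (fpsX ^+ k * f) n = if (k <= n)%N then f (n - k)%N else 0.
Proof.
elim: k n => [|k IH] n; first by rewrite expr0 mul1r subn0.
by rewrite exprS -mulrA coef_fpsXM; case: n => // n; rewrite IH.
Qed.

Lemma coef_fps_sum_nat (R : comNzRingType) (F : nat -> fps R) n N :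
    (forall p, (N <= p)%N -> F p n = 0) ->
  fps_sum setT F n = \sum_(p < N) F p n.
Proof.
move=> F0; rewrite /= (fsbig_ord _ _ (fun p => F p n)).
apply/esym/fsbig_widen => // p [_ /= /negP]; rewrite -leqNgt; exact: F0.
Qed.

Lemma fps_sum_pair (R : comNzRingType) (I : choiceType) (x y : I)
    (F : I -> fps R) : x != y -> fps_sum [set x; y] F = F x + F y.
Proof.
move=> xy; apply/fpsP => n /=.
rewrite fsbigU0//=; first by rewrite !fsbig_set1.
by move=> z [/= -> yx]; rewrite yx eqxx in xy.
Qed.

(** * Towers over a chain of two-element sets closed under [mcm] *)

Section UniqueTower.
Variables (M : monoidType) (I : nat -> set M).
Hypothesis cardI : forall k, Defs.card (I k) = 2%N.
Hypothesis mcmI : forall k, mcm (I k) = I k.+1.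

(** [fset_set] sends an infinite set to the empty one, so [card] would be 0 instead of 2. *)
Let finI k : finite_set (I k).
Proof.
apply: contrapT => infI; have := cardI k.
by rewrite /Defs.card /fset_set; case: pselect; rewrite ?cardfs0.
Qed.

Let subset_eq k J : J `<=` I k -> (1 < Defs.card J)%N -> J = I k.
Proof.
move=> JI cJ; have finJ : finite_set J by exact: sub_finite_set JI (finI k).
apply: (fset_set_inj finJ (finI k)); apply/eqP.
rewrite eqEfcard; apply/andP; split; first by rewrite -fset_set_sub.
by rewrite [X in (X <= _)%N](cardI k).
Qed.

Let nth_mcm Js k : (k <= size Js)%N ->
    (forall j, (j < k)%N -> nth set0 Js j = I j) ->
  nth set0 (I 0 :: map (@mcm M) Js) k = I k.
Proof. by case: k => // k kJs IH /=; rewrite (nth_map set0)// IH// mcmI. Qed.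

(** By strong induction: once the earlier entries are forced, the next one is a subset of [I k] with
    more than one element, hence all of [I k]. *)
Lemma towerE Js : tower (I 0) Js <-> Js = mkseq I (size Js).
Proof.
split=> [T|JsE k kJs /=].
  apply: (@eq_from_nth _ set0) => [|k]; first by rewrite size_mkseq.
  elim/ltn_ind: k => k IH kJs; rewrite nth_mkseq//.
  have [+ _ cJ _] := T k kJs; rewrite nth_mcm ?(ltnW kJs)//.
    by move=> JI; exact: subset_eq.
  move=> j jk; have jJs := ltn_trans jk kJs.
  by rewrite IH// nth_mkseq.
have JsI j : (j < size Js)%N -> nth set0 Js j = I j.
  by move=> jJs; rewrite JsE nth_mkseq.
rewrite nth_mcm ?(ltnW kJs)//; last by move=> j /ltn_trans/(_ kJs)/JsI.
rewrite JsI// cardI mcmI; split=> //; apply/set0P/eqP => I0.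
by have := cardI k.+1; rewrite I0 /Defs.card fset_set0 cardfs0.
Qed.

Lemma tower_top_mkseq p : tower_top (I 0) (mkseq I p) = I p.
Proof.
rewrite /tower_top (last_nth set0) size_map nth_mcm//.
  by rewrite size_mkseq.
by move=> j; rewrite size_mkseq => jp; rewrite nth_mkseq.
Qed.

Lemma tower_sign_mkseq p : tower_sign (mkseq I p) = - (-1) ^+ p.
Proof.
rewrite /tower_sign size_mkseq big_map (eq_bigr (fun=> 2)) => [|k _].
  (* With all cardinalities equal to 2, the exponent is 2p - p + 1 = p + 1. *)
  rewrite big_const_seq count_predT size_iota iter_addn_0 mul2n -addnn addnK.
  by rewrite addn1 exprS mulN1r.
exact: cardI.
Qed.

Lemma skew_growth_unique (deg : M -> nat) :
  skew_growth (I 0) deg = 1 + fps_sum setT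
    (fun p => - (-1) ^+ p * fps_sum (I p) (fun D => fpsX ^+ deg D)).
Proof.
congr (1 + _); apply/fpsP => n /=.
have -> : tower (I 0) = range (mkseq I).
  apply/seteqP; split=> [Js /towerE ->|_ [p _ <-]]; first by exists (size Js).
  by apply/towerE; rewrite size_mkseq.
(* Towers are indexed by their height; [mkseq I] is injective because the size recovers p. *)
rewrite (reindex_fsbig (mkseq I) setT) /=; last first.
  split=> [p _|p q _ _ /(congr1 size)|//]; first by exists p.
  by rewrite !size_mkseq.
apply: eq_fsbigr => p _.
by rewrite /tower_term tower_sign_mkseq tower_top_mkseq.
Qed.

End UniqueTower.

(** * Divisibility and minimal common multiples of pairs *)

Lemma ldivides_trans (M : monoidType) (x y z : M) :
  ldivides x y -> ldivides y z -> ldivides x z.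
Proof. by move=> [t ->] [s ->]; exists (t * s)%g; rewrite mulgA. Qed.

Lemma cm_r_pair (M : monoidType) (u v x : M) :
  cm_r [set u; v] x <-> ldivides u x /\ ldivides v x.
Proof.
by split=> [h|[ux vx] y [] /= ->//]; split; apply: h; [left|right].
Qed.

(** Every common multiple lies above u or v, so only these can be minimal; incomparability and
    antisymmetry make both minimal. *)
Lemma mcm_pair (M : monoidType) (J : set M) (u v : M) :
    (forall x, cm_r J x <-> ldivides u x \/ ldivides v x) ->
    ~ ldivides u v -> ~ ldivides v u ->
    (forall x y : M, ldivides x y -> ldivides y x -> x = y) ->
  mcm J = [set u; v].
Proof.
move=> cmE uv vu anti.
have refl (x : M) : ldivides x x by exists 1%g; rewrite mulg1.
have [cmu cmv] : cm_r J u /\ cm_r J v by split; apply/cmE; [left|right].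
apply/seteqP; split=> x.
  move=> [/cmE[ux|vx] xmin]; [left|right]; exact/esym/xmin.
case=> /= ->; split=> // y /cmE[] dy yd; try exact: anti.
  by case: vu; exact: ldivides_trans dy yd.
by case: uv; exact: ldivides_trans dy yd.
Qed.

(** * Monomials and equality in the abelian monoid *)

Section Abel.
Variable m : nat.
Hypothesis hm : (2 <= m)%N.
Local Notation R := (abel_relations m).
Local Notation M := (presented R).

(** Exponents are left unreduced, so an element may have several such names; [monomialP] tells when
    two agree. *)
Definition monomial i j : M := word R (nseq i false ++ nseq j true).

Lemma abel_comm w : mo_cong R (rcons w true) (true :: w).
Proof.
elim: w => [|c w IH]; first exact: mo_refl.
apply: (mo_trans (mo_cat (mo_refl R [:: c]) IH)) => /=.
case: c; first exact: mo_refl.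
apply: (@mo_cat _ R [:: false; true] [:: true; false] w w); last exact: mo_refl.
by apply: mo_rel; rewrite !inE eqxx orbT.
Qed.

Lemma monomialM i j i' j' :
  (monomial i j * monomial i' j')%g = monomial (i + i') (j + j').
Proof.
rewrite -word_cat; apply/wordP; rewrite !nseqD -!catA.
apply: mo_cat; first exact: mo_refl.
rewrite !catA; apply: mo_cat; last exact: mo_refl.
(* With the outer a^i and b^j' stripped, it remains to move b^j past a^i', one b at a time. *)
elim: j => [|j IH]; first by rewrite cats0; exact: mo_refl.
apply: (mo_trans (mo_cat (mo_refl R [:: true]) IH)).
apply: mo_sym.
rewrite (_ : _ ++ nseq j.+1 _ = rcons (nseq i' false) true ++ nseq j true).
  exact: (mo_cat (abel_comm _) (mo_refl _ _)).
by rewrite cat_rcons.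
Qed.

Lemma monomial_surj (x : M) : exists i j, x = monomial i j.
Proof.
rewrite -(word_repr x); elim: (repr x) => [|c w [i [j IH]]].
  by exists 0, 0.
rewrite -cat1s word_cat IH.
by case: c; [exists i, j.+1|exists i.+1, j];
   [rewrite -[X in (X * _)%g]/(monomial 0 1)|
    rewrite -[X in (X * _)%g]/(monomial 1 0)]; rewrite monomialM.
Qed.

(** [count id] counts the letter b; a^m = b^m changes this count by m and commutation preserves
    it. *)
Lemma abel_cong_count (u v : seq bool) :
  mo_cong R u v -> count id u = count id v %[mod m].
Proof.
elim=> {u v} [u v|//|u v _ -> //|u v w _ -> _ -> //|u u' v v' _ uu' _ vv'].
  rewrite !inE => /orP[] /eqP[-> ->] //=.
  by rewrite !count_nseq mul0n mul1n modnn mod0n.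
by rewrite !count_cat -modnDm uu' vv' modnDm.
Qed.

Lemma monomialDm i j : monomial (i + m) j = monomial i (j + m).
Proof.
rewrite -{1}[j]addn0 -monomialM -[X in _ = monomial X _]addn0 -monomialM.
congr (_ * _)%g; apply/wordP; rewrite /= cats0.
by apply: mo_rel; rewrite inE eqxx.
Qed.

Lemma monomialDMm i j k : monomial (i + k * m) j = monomial i (j + k * m).
Proof.
elim: k j => [|k IH] j; first by rewrite !addn0.
by rewrite mulSn [(m + _)%N]addnC !addnA monomialDm IH addnAC.
Qed.

Lemma deg_monomial i j : deg (monomial i j) = (i + j)%N.
Proof.
by rewrite deg_word ?size_cat ?size_nseq//; exact: homogeneous_abel.
Qed.

(** Degree and b-count mod m are invariants. Conversely, for j <= j' the excess j' - j = km of
    letters b is traded for km letters a. *)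
Lemma monomialP i j i' j' : monomial i j = monomial i' j' <->
  (i + j = i' + j')%N /\ j = j' %[mod m].
Proof.
split=> [E|].
  split; first by rewrite -!deg_monomial E.
  have /wordP/abel_cong_count := E.
  by rewrite !count_cat !count_nseq !mul0n !mul1n.
wlog jj' : i j i' j' / (j <= j')%N => [hw [d e]|[d /eqP]].
  have [/hw|/ltnW/hw] := leqP j j'; first exact.
  by move=> h; apply/esym/h.
rewrite eq_sym eqn_mod_dvd// => /dvdnP[k jk].
have -> : j' = (j + k * m)%N by rewrite -jk subnKC.
by rewrite -monomialDMm; congr monomial; lia.
Qed.

Lemma monomial_dvd i j i' j' : (i <= i')%N -> (j <= j')%N ->
  ldivides (monomial i j) (monomial i' j').
Proof.
move=> ii' jj'; exists (monomial (i' - i) (j' - j)).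
by rewrite monomialM !subnKC.
Qed.

Lemma monomial_dvdP i j (x : M) : ldivides (monomial i j) x ->
  exists p q, x = monomial (i + p) (j + q).
Proof.
move=> [y ->]; have [p [q ->]] := monomial_surj y.
by exists p, q; rewrite monomialM.
Qed.

Lemma ldivides_abel_anti (x y : M) : ldivides x y -> ldivides y x -> x = y.
Proof.
have [i [j ->]] := monomial_surj x; move=> /monomial_dvdP[p [q ->]].
move=> /monomial_dvdP[p' [q' /monomialP[E _]]].
have [-> ->] : p = 0%N /\ q = 0%N by split; lia.
by rewrite !addn0.
Qed.

Lemma modn_eq0_leq q : 0%N = q.+1 %[mod m] -> (m <= q.+1)%N.
Proof. by rewrite mod0n => /esym/eqP; exact: dvdn_leq. Qed.

(** * The two alternating [mcm] computations *)

Lemma mcm_ab K :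
  mcm [set monomial K.+1 0; monomial K 1]
    = [set monomial K.+1 1; monomial (K + m) 0].
Proof.
apply: mcm_pair => [x| | |]; last exact: ldivides_abel_anti.
- rewrite cm_r_pair; split=> [[]|[] ux].
  + move=> /monomial_dvdP[p [q xE]] /monomial_dvdP[p' [q' xE']].
    have := xE; rewrite {1}xE' add0n add1n => /monomialP[_].
    (* If q = 0, then m divides 1 + q', so b^m can be extracted from x and turned into a^m;
       otherwise x contains a^(K+1) b. *)
    case: q xE => [_ /esym/modn_eq0_leq mq|q -> _].
      right; rewrite xE' add1n -(subnK mq) -monomialDm.
      by apply: monomial_dvd; lia.
    by left; apply: monomial_dvd; lia.
  + by split; apply: ldivides_trans ux; apply: monomial_dvd.
  + split; apply: ldivides_trans ux; last rewrite monomialDm;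
    by apply: monomial_dvd; lia.
(* A b-exponent 1 + q >= m, together with a^(K+1), exceeds the degree K + m. *)
- move=> /monomial_dvdP[p [q /monomialP[d /modn_eq0_leq]]].
  lia.
(* The degree equation K + 2 = K + m + p + q leaves q = 0, and 0, 1 are not congruent mod m. *)
- move=> /monomial_dvdP[p [q /monomialP[d]]].
  have -> : q = 0%N by lia.
  by rewrite mod0n modn_small.
Qed.

Lemma mcm_ab_am K :
  mcm [set monomial K.+1 1; monomial (K + m) 0]
    = [set monomial (K + m).+1 0; monomial (K + m) 1].
Proof.
apply: mcm_pair => [x| | |]; last exact: ldivides_abel_anti.
- rewrite cm_r_pair; split=> [[]|[] ux].
  + move=> /monomial_dvdP[p [q xE]] /monomial_dvdP[p' [q' xE']].
    have := xE'; rewrite {1}xE add0n add1n => /monomialP[_].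
    (* The same dichotomy: q' = 0 releases a factor b^m = a^m next to a^(K+1), otherwise x contains
       a^(K+m) b. *)
    case: q' xE' => [_ /esym/modn_eq0_leq mq|q' -> _].
      left; rewrite xE add1n -(subnK mq) -monomialDm.
      by apply: monomial_dvd; lia.
    by right; apply: monomial_dvd; lia.
  + split; apply: ldivides_trans ux; first rewrite -addSn monomialDm;
    by apply: monomial_dvd; lia.
  + by split; apply: ldivides_trans ux; apply: monomial_dvd; lia.
- move=> /monomial_dvdP[p [q /monomialP[d]]].
  have -> : q = 0%N by lia.
  by rewrite mod0n modn_small.
- move=> /monomial_dvdP[p [q /monomialP[d]]].
  have -> : q = 0%N by lia.
  by rewrite mod0n modn_small.
Qed.

(** * The tops of the towers and their contributions *)

Definition level p : set M :=
  let K := (p./2 * m)%N in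
  if odd p then [set monomial K.+1 1; monomial (K + m) 0]
  else [set monomial K.+1 0; monomial K 1].

Lemma mcm_level p : mcm (level p) = level p.+1.
Proof.
rewrite /level /= uphalf_half; case: (odd p) => /=.
  by rewrite mcm_ab_am add1n mulSn addnC.
by rewrite mcm_ab.
Qed.

Lemma generators_level : @generators _ R = level 0.
Proof.
apply/seteqP; split=> [_ [[] _ <-]|_ [] ->]; first by right.
- by left.
- by exists false.
- by exists true.
Qed.

Lemma neq_monomial i i' : monomial i 1 != monomial i' 0.
Proof. by apply/eqP => /monomialP[_]; rewrite mod0n modn_small. Qed.

Lemma card_level p : Defs.card (level p) = 2%N.
Proof.
(* The swap puts the element with b-exponent 1 first, as in [neq_monomial]. *)
rewrite /level; case: (odd p); last rewrite setUC.
all: by rewrite /Defs.card fset_setU// !fset_set1 cardfs2 neq_monomial.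
Qed.

Lemma fps_sum_level p :
  fps_sum (level p) (fun D => fpsX ^+ deg D) =
  (if odd p then fpsX ^+ 2 + fpsX ^+ m else fpsX + fpsX)
    * fpsX ^+ (p./2 * m) :> fps int.
Proof.
rewrite /level; case: (odd p); last rewrite setUC.
all: rewrite fps_sum_pair ?neq_monomial// !deg_monomial ?addn0 ?addn1.
  by rewrite -addn2 !exprD; ring.
by rewrite !exprS; ring.
Qed.

Lemma skew_growth_abel_sum :
  presented_skew_growth R = 1 + fps_sum setT (fun p =>
    - (-1) ^+ p * ((if odd p then fpsX ^+ 2 + fpsX ^+ m else fpsX + fpsX)
                   * fpsX ^+ (p./2 * m))).
Proof.
rewrite /presented_skew_growth generators_level.
rewrite (skew_growth_unique card_level mcm_level).
congr (1 + fps_sum _ _); apply/funext => p.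
by rewrite fps_sum_level.
Qed.

End Abel.

(** * Summation of the series *)

Lemma fps_sum_nat_period2 (R : comNzRingType) (F : nat -> fps R) m :
    (0 < m)%N -> (forall p n, (n < p)%N -> F p n = 0) ->
    (forall p, F p.+2 = fpsX ^+ m * F p) ->
  fps_sum setT F = F 0 + F 1 + fpsX ^+ m * fps_sum setT F.
Proof.
move=> m0 F0 FS; apply/fpsP => n.
(* Truncating at n + 2 leaves exactly n terms once the first two are split off. *)
rewrite (@coef_fps_sum_nat _ _ _ n.+2); last by move=> p /ltnW; exact: F0.
rewrite !big_ord_recl addrA; congr (_ + _).
rewrite coef_fpsXnM; case: leqP => [mn|nm].
  (* As m > 0, the coefficient at n - m < n already vanishes from p = n on. *)
  rewrite (@coef_fps_sum_nat _ _ _ n); last first.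
    by move=> p np; apply: F0; lia.
  by apply: eq_bigr => p _; rewrite /= FS coef_fpsXnM mn.
by rewrite big1 // => p _; rewrite /= FS coef_fpsXnM leqNgt nm.
Qed.

Theorem mainTheorem4 (m : nat) (hm : (2 <= m)%N) :
  presented_skew_growth (abel_relations m)
    = (1 - fpsX) ^+ 2 / (1 - fpsX ^+ m) :> fps int.
Proof.
apply: (canRL (mulrK _)); first by apply: unit_1subXn; exact: ltnW.
rewrite skew_growth_abel_sum//.
set F := fun p : nat => _.
have FS p : F p.+2 = fpsX ^+ m * F p.
  by rewrite /F /= negbK mulSn exprD !exprS; ring.
(* Since m >= 2, the monomial factor has order at least 2 floor(p/2). This settles even p; for odd p
   only the constant term of t^2 + t^m could contribute, and it is 0. *)
have F0 p n : (n < p)%N -> F p n = 0.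
  move=> np; have p2 := odd_double_half p.
  have lt_half : (p./2.*2 <= p./2 * m)%N by rewrite -muln2 leq_mul.
  rewrite /F mulrA mulrC coef_fpsXnM; case: leqP => // le_n.
  have podd : odd p by case: (odd p) p2 => // p2; lia.
  have -> : (n - p./2 * m = 0)%N by lia.
  rewrite podd -signr_odd podd expr1 opprK mul1r coef_fpsD !coef_fpsXn.
  by case: (m) hm => // -[].
have E := fps_sum_nat_period2 (ltnW hm) F0 FS.
(* Here [F 0] is -2t and [F 1] is t^2 + t^m. *)
have -> : (1 - fpsX) ^+ 2 = 1 - fpsX ^+ m + F 0 + F 1 :> fps int.
  by rewrite /F /=; ring.
have -> : 1 - fpsX ^+ m + F 0 + F 1
    = 1 - fpsX ^+ m + (fps_sum setT F - fpsX ^+ m * fps_sum setT F).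
  by rewrite -addrA {1}E addrK.
by ring.
Qed.
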